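(* Let $(G_k)_{k=1}^\infty$ be a sequence of finite simple graphs such that $G_k$ has minimum degree at least $k$ for every $k$ (with no assumption on the number of vertices of $G_k$), and let $p=p(k)\in[0,1]$ be such that $p(k)\,k\to\infty$ as $k\to\infty$. Then with high probability $G_k[p]$ contains a cycle of length at least $(1-o(1))k$. That is, for every constant $\delta>0$, the probability that $G_k[p]$ contains a cycle of length at least $(1-\delta)k$ tends to $1$ as $k\to\infty$.
   Context: For a graph $G_k$ and $p=p(k)\in[0,1]$, $G_k[p]$ denotes the random spanning subgraph of $G_k$ obtained by retaining each edge of $G_k$ with probability $p$, independently of the other edges. An event (depending on $k$) holds with high probability if its probability tends to $1$ as $k\to\infty$. The length of a cycle is its number of edges. *)

(* Defs.v *)
From HB Require Import structures.
From mathcomp Require Import all_boot all_order all_algebra.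
From mathcomp Require Import boolp reals.

Set Implicit Arguments.
Unset Strict Implicit.
Unset Printing Implicit Defensive.

Import Order.TTheory GRing.Theory Num.Theory.
Local Open Scope ring_scope.

Record sgraph := SGraph {
  vertex :> finType;
  adj : rel vertex;
  adj_sym : symmetric adj;
  adj_irrefl : irreflexive adj }.

Definition degree (G : sgraph) (x : G) : nat := #|[set y | adj x y]|.

(* The vertex set must be nonempty: the null graph has no minimum degree. *)
Definition min_degree_at_least (G : sgraph) (d : nat) : Prop :=
  (0 < #|G|)%N /\ forall x : G, (d <= degree x)%N.

Definition edges (G : sgraph) : {set {set G}} :=
  [set [set u.1; u.2] | u : G * G & adj u.1 u.2].

Section SpanningSubgraph.
Variables (G : sgraph) (F : {set {set G}}).

Definition span_adj : rel G := [rel x y | adj x y && ([set x; y] \in F)].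

Lemma span_adj_sym : symmetric span_adj.
Proof. by move=> x y; rewrite /span_adj /= adj_sym setUC. Qed.

Lemma span_adj_irrefl : irreflexive span_adj.
Proof. by move=> x; rewrite /span_adj /= adj_irrefl. Qed.

Definition spanning_subgraph : sgraph := SGraph span_adj_sym span_adj_irrefl.

End SpanningSubgraph.

(* The bound 2 < size c is needed since [ucycle] accepts a single edge,
   traversed back and forth, as well as the empty sequence. *)
Definition is_cycle (G : sgraph) (c : seq G) : Prop :=
  (2 < size c)%N /\ ucycle (@adj G) c.

Definition has_cycle_at_least (R : realType) (l : R) (G : sgraph) : Prop :=
  exists c : seq G, is_cycle c /\ l <= (size c)%:R.

(* Probability that the set of retained edges of G is exactly F, each edge being
   retained independently with probability p. *)
Definition retain_weight (R : realType) (G : sgraph) (p : R)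
    (F : {set {set G}}) : R :=
  \prod_(f in edges G) (if f \in F then p else 1 - p).

(* Probability that the random spanning subgraph G[p] satisfies A. *)
Definition Pr_perc (R : realType) (G : sgraph) (p : R) (A : sgraph -> Prop) : R :=
  \sum_(F in powerset (edges G) | `[< A (spanning_subgraph F) >])
    retain_weight p F.

(* Main.v *)
(* Two rounds of exposure, 1 - p = (1 - p1)(1 - p2) with p1 = p/2, in the spirit
   of Riordan's short proof.

   Depth-first search on the first round F tests the edges of G one at a time.
   Every successful test reaches a new vertex, and whether an edge gets tested
   does not depend on its own state, so the expected number of tested edges is at
   most |G|/p1 = o(k|G|). Every untested edge joins a vertex to one of its
   ancestors in the search forest.

   If some vertex has many untested edges spanning a distance of about k in the
   forest, the second round contains one of them and closes a long cycle.
   Otherwise all but o(|G|) vertices have linearly (in k) many descendants at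
   distance < k, which forces all but o(|G|) vertices to have height at least Ck
   for any constant C. As ancestors and descendants at bounded distance are
   equinumerous on average, most vertices have hardly more than d descendants at
   distance at most d = (1 - o(1))k, hence linearly many untested edges to
   ancestors; and some ancestor line of length Ck consists almost entirely of
   such vertices. Cut it into boundedly many blocks: with high probability the
   second round contains an upward chord from each block, and a chain of
   overlapping chords yields a cycle of length at least k. *)
Require Import Defs.
From mathcomp Require Import all_boot.
From mathcomp Require Import zify.

Set Implicit Arguments.
Unset Strict Implicit.
Unset Printing Implicit Defensive.

(** * Cycles from overlapping chords, and rooted forests *)

Section OverlappingChords.
Variables (r : rel nat) (L : nat).
Hypothesis r_sym : symmetric r.
Hypothesis r_succ : forall i, i.+1 < L -> r i i.+1.

(* In [open_ladder x y c], [rev (y :: c)] is a path of positions from x to y that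
   stays at or below x except at its end y. Walking from x to y along the
   positions closes it into a cycle; a chord from between x and y to a position t
   above y turns it into an open ladder between y and t. *)
Definition open_ladder x y (c : seq nat) :=
  [/\ x < y < L, path r y c, last y c = x, uniq c & all (geq x) c].

Lemma iota_path x n : x + n < L -> path r x (iota x.+1 n).
Proof.
elim: n x => //= n IH x xL; rewrite r_succ ?IH //; lia.
Qed.

Lemma last_iota x n : last x (iota x.+1 n) = x + n.
Proof. by elim: n x => [|n IH] x /=; rewrite ?addn0 // IH addSnnS. Qed.

Lemma open_ladder_chord x y : x < y < L -> r x y -> open_ladder x y [:: x].
Proof. by move=> xyL rxy; split; rewrite //= ?andbT // r_sym. Qed.

(** From [t] the new path crosses the chord to [s], descends to [x + 1], then follows [c] backwards
    from [x] to [y]. *)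
Lemma open_ladder_step x y c s t : open_ladder x y c ->
  x < s < y -> y < t < L -> r s t ->
  open_ladder y t (rev (y :: c ++ iota x.+1 (s - x))).
Proof.
move=> [/andP[xy yL] pc lc uc /allP ac] /andP[xs sy] ytL rst; split=> //.
- have {1}-> : t = last y (rcons (c ++ iota x.+1 (s - x)) t) by rewrite last_rcons.
  rewrite -[X in rev X](belast_rcons y _ t) rev_path.
  rewrite (eq_path (e' := r)); last by move=> i j; rewrite r_sym.
  rewrite rcons_path cat_path pc lc last_cat lc last_iota iota_path ?subnKC //; lia.
- by rewrite rev_cons last_rcons.
- rewrite rev_uniq /= mem_cat negb_or cat_uniq uc iota_uniq andbT /=.
  apply/andP; split.
  + apply/andP; split; first by apply/negP => /ac /=; lia.
    by rewrite mem_iota; lia.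
  + by apply/hasPn => i; rewrite mem_iota => h; apply/negP => /ac /=; lia.
- rewrite all_rev /= leqnn /= all_cat; apply/andP; split; apply/allP => i.
    by move/ac => /=; lia.
  by rewrite mem_iota /=; lia.
Qed.

(** Since [c] stays at or below [x], the positions strictly between [x] and [y] are free to lead
    back to [y]. *)
Lemma open_ladder_close x y c : open_ladder x y c ->
  exists2 z, size z = size c + (y - x) & [/\ cycle r z, uniq z & all (gtn L) z].
Proof.
move=> [/andP[xy yL] pc lc uc /allP ac]; exists (y :: c ++ iota x.+1 (y - x).-1).
  by rewrite /= size_cat size_iota; lia.
split.
- rewrite /= rcons_cat cat_path pc lc.
  have -> : rcons (iota x.+1 (y - x).-1) y = iota x.+1 (y - x).
    by rewrite -{2}(@prednK (y - x)) ?subn_gt0 // -[(_ - _).-1.+1]addn1 iotaD -cats1 /=;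
      congr (_ ++ [:: _]); lia.
  by rewrite iota_path ?subnKC // ltnW.
- rewrite /= mem_cat negb_or cat_uniq uc iota_uniq mem_iota andbT.
  apply/andP; split.
  + apply/andP; split; [by apply/negP => /ac /=; lia|lia].
  + by apply/hasPn => i; rewrite mem_iota => h; apply/negP => /ac /=; lia.
- rewrite /= yL /= all_cat; apply/andP; split; apply/allP => i.
    by move/ac => /=; lia.
  by rewrite mem_iota /=; lia.
Qed.

(* Passing from chord to chord loses twice the overlap, which is at most 2b, while
   every chord has length at least 5b: the cycle length grows by b per chord. *)
Lemma chords_open_ladder b k M N : 0 < b <= k -> N.+1 * k <= M * b ->
  (forall j, j < M -> exists s t,
     [/\ j * b <= s < j.+1 * b, s + 5 * b <= t <= s + k, t < L & r s t]) ->
  exists x y c, [/\ open_ladder x y c, x + 3 * b <= y <= N.+2 * k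
     & N * b <= size c + (y - x)].
Proof.
move=> /andP[b0 bk] NM chord; elim: N NM => [|N IH] NM.
  have [|s [t [hs ht tL rst]]] := chord 0; first by nia.
  exists s, t, [:: s]; split; [apply: open_ladder_chord => //; lia|lia|lia].
have [|x [y [c [sc hy hc]]]] := IH; first by nia.
have hyb := divn_eq y b; have hyb' := ltn_pmod y b0.
have yb0 : 0 < y %/ b by rewrite divn_gt0 //; lia.
(* The block just before that of [y] gives [y - 2 * b < s < y]; as [x + 3 * b <= y], this [s] also
   lies beyond [x]. *)
have [|s [t [hs ht tL rst]]] := chord (y %/ b).-1; first by nia.
have sy : y - 2 * b < s < y by nia.
exists y, t, (rev (y :: c ++ iota x.+1 (s - x))); split.
- apply: open_ladder_step => //; lia.
- by apply/andP; split; nia.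
- rewrite size_rev /= size_cat size_iota; nia.
Qed.

End OverlappingChords.

(** * Counting ancestors and descendants in a rooted forest *)

Section Forest.
Variables (V : finType) (anc : V -> seq V).
Hypothesis anc_self : forall v, exists s, anc v = v :: s.
Hypothesis anc_suffix : forall v l w s, anc v = l ++ w :: s -> anc w = w :: s.
Hypothesis anc_uniq : forall v, uniq (anc v).
Implicit Types (S Y : {set V}).

(* [anc v] lists the path from v up to its root; [up m v] and [down m v] hold the
   proper ancestors and descendants at distance at most m. *)
Definition up m v := take m (behead (anc v)).
Definition down m v := [set u | v \in up m u].
Definition tall m v := [exists u, (v \in anc u) && (m <= index v (anc u))].

Lemma uniq_up m v : uniq (up m v).
Proof. by rewrite take_uniq // -drop1 drop_uniq. Qed.

Lemma size_up m v : size (up m v) <= m.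
Proof. by rewrite size_take_min geq_minl. Qed.

Lemma mem_up m v u : (u \in up m v) = (u \in anc v) && (0 < index u (anc v) <= m).
Proof.
have [s es] := anc_self v; have := anc_uniq v; rewrite /up es /= => /andP[vs us].
rewrite in_cons [u == v]eq_sym; case: (eqVneq v u) => [<-|vu] /=.
  by apply/negbTE; apply: contra vs => /mem_take.
have [us'|us'] := boolP (u \in s); last by apply/negbTE; apply: contra us' => /mem_take.
by rewrite in_take.
Qed.

(** Double counting of the ancestor-descendant pairs at distance at most [m]. *)
Lemma sum_card_down m (P : pred V) :
  \sum_(v | P v) #|down m v| = \sum_u count P (up m u).
Proof.
transitivity (\sum_(v | P v) \sum_u (v \in up m u : nat)).
  by apply: eq_bigr => v _; rewrite -sum1dep_card big_mkcond; apply: eq_bigr => u _; case: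
    (v \in _).
rewrite exchange_big; apply: eq_bigr => u _ /=.
rewrite -size_filter -(card_uniqP (filter_uniq _ (uniq_up m u))) -sum1_card.
rewrite [LHS]big_mkcond [RHS]big_mkcond; apply: eq_bigr => v _.
by rewrite mem_filter; case: (P v); case: (v \in _).
Qed.

Lemma sum_card_downI m S : \sum_v #|down m v :&: S| <= m * #|S|.
Proof.
have -> : \sum_v #|down m v :&: S| = \sum_(u in S) size (up m u).
  transitivity (\sum_v \sum_(u in S) (v \in up m u : nat)).
    apply: eq_bigr => v _; rewrite -sum1_card big_mkcond [RHS]big_mkcond.
    by apply: eq_bigr => u _; rewrite !inE andbC; case: (u \in S); case: (v \in _).
  rewrite exchange_big; apply: eq_bigr => u _ /=.
  by rewrite -(card_uniqP (uniq_up m u)) -sum1_card [RHS]big_mkcond; apply: eq_bigr => v _;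
    case: (v \in _).
by rewrite mulnC -sum_nat_const; apply: leq_sum => u _; apply: size_up.
Qed.

Lemma leq_tall d m v : d <= m -> tall m v -> tall d v.
Proof.
by move=> dm /existsP[u /andP[vu mi]]; apply/existsP; exists u; rewrite vu (leq_trans dm).
Qed.

Lemma ancP v u : reflect (exists l s, anc u = l ++ v :: s /\ index v (anc u) = size l) (v \in anc u).
Proof.
apply: (iffP idP) => [vu|[l [s [-> _]]]]; last by rewrite mem_cat inE eqxx orbT.
exists (take (index v (anc u)) (anc u)), (drop (index v (anc u)).+1 (anc u)).
have vsz : index v (anc u) < size (anc u) by rewrite index_mem.
have := drop_nth v vsz; rewrite nth_index // => <-.
by rewrite cat_take_drop size_takel // index_size.
Qed.

(** On the path up from a descendant at distance at least [m], the last [m] vertices before [v] are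
    descendants within distance [m]. *)
Lemma leq_card_down m v : tall m v -> m <= #|down m v|.
Proof.
move=> /existsP[u /andP[/ancP[l [s [eu ->]]] ml]].
have ul : uniq l by have := anc_uniq u; rewrite eu cat_uniq => /andP[].
have card_l : #|drop (size l - m) l| = m.
  by rewrite (card_uniqP (drop_uniq _ ul)) size_drop subKn.
rewrite -[X in X <= _]card_l; apply: subset_leq_card; apply/subsetP => x xl; rewrite inE mem_up.
have [l1 [l2 el]] : exists l1 l2, drop (size l - m) l = l1 ++ x :: l2.
  by case/splitPr: xl => l1 l2; exists l1, l2.
have ex : anc x = x :: l2 ++ v :: s.
  by apply: (anc_suffix (v := u) (l := take (size l - m) l ++ l1));
    rewrite eu -{1}(cat_take_drop (size l - m) l) el -!catA.
have sl2 : size l2 < m.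
  have := congr1 size el; rewrite size_drop size_cat /=; lia.
have := anc_uniq x; rewrite ex cons_uniq mem_cat inE cat_uniq => /and3P[].
rewrite /= !negb_or => /and3P[_ xv _] _ /andP[/andP[vl2 _] _].
rewrite inE mem_cat !inE eqxx !orbT /= (negbTE xv).
by rewrite index_cat (negbTE vl2) /= eqxx addn0.
Qed.

Lemma anc_trans u v w : u \in anc v -> v \in anc w ->
  (u \in anc w) /\ index u (anc w) = index u (anc v) + index v (anc w).
Proof.
move=> uv /ancP[l [s [ew ->]]].
have ev : anc v = v :: s by apply: anc_suffix ew.
split; first by rewrite ew mem_cat -ev uv orbT.
have := anc_uniq w; rewrite ew -ev cat_uniq => /and3P[_ /hasPn/(_ u uv) ul _].
by rewrite index_cat (negbTE ul) addnC.
Qed.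

(* Below v, a deepest vertex outside S has all its descendants in S; hence v has
   at least alpha descendants in S, all within distance m if v is not tall. *)
Lemma card_not_tall S d m alpha : d <= m ->
  (forall v, v \notin S -> alpha <= #|down d v|) ->
  alpha * #|[set v | ~~ tall m v] :\: S| <= m * #|S|.
Proof.
move=> dm large; rewrite mulnC -sum_nat_const.
apply: leq_trans (sum_card_downI m S).
rewrite [X in _ <= X](bigID (mem ([set v | ~~ tall m v] :\: S))) /=.
apply: leq_trans (leq_addr _ _); apply: leq_sum => v; rewrite !inE => /andP[vS not_tall].
have v_anc x : x \in anc x by have [s ->] := anc_self x; rewrite mem_head.
have vP : (v \notin S) && (v \in anc v) by rewrite vS v_anc.
case: (@arg_maxnP _ v (fun w => (w \notin S) && (v \in anc w)) (fun w => size (anc w)) vP).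
move=> w /andP[wS vw] w_max; apply: leq_trans (large w wS) _.
apply: subset_leq_card; apply/subsetP => u; rewrite !inE !mem_up => /and3P[wu iu _].
have [vu ivu] := anc_trans vw wu; rewrite vu ivu.
have -> : u \in S.
  apply/negPn/negP => uS; have := w_max u; rewrite uS vu => /(_ isT).
  have /ancP[l [s [eu il]]] := wu; rewrite eu (anc_suffix eu) /= size_cat /= -il; lia.
rewrite andbT /=; apply/andP; split; first by lia.
rewrite -ivu leqNgt; apply: contra not_tall => h; apply/existsP; exists u.
by rewrite vu ltnW.
Qed.

(* The number of descendants within distance d is at most d on average, and at
   least d outside Y. *)
Lemma card_heavy Y d e : (forall v, v \notin Y -> tall d v) ->
  e * #|[set v | d + e <= #|down d v|] :\: Y| <= d * #|Y|.
Proof.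
move=> tallY; set H := _ :\: Y.
have total : \sum_v #|down d v| <= d * #|V|.
  rewrite sum_card_down mulnC -sum_nat_const; apply: leq_sum => u _.
  by rewrite count_predT size_up.
have YH : [disjoint Y & H].
  by rewrite -setI_eq0; apply/eqP/setP => v; rewrite !inE; case: (v \in Y).
have : d * (#|V| - #|Y|) + e * #|H| <= \sum_v #|down d v|.
  rewrite (bigID (mem Y)) /=; apply: leq_trans (leq_addl _ _).
  have -> : #|V| - #|Y| = #|~: Y| by rewrite -(cardsC Y) addKn.
  rewrite mulnC -sum_nat_const.
  have -> : \sum_(v in ~: Y) d = \sum_(v | v \notin Y) d by apply: eq_bigl => v; rewrite inE.
  rewrite mulnC -sum_nat_const.
  have -> : \sum_(v in H) e = \sum_(v | v \notin Y) (if v \in H then e else 0).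
    by rewrite -big_mkcondr; apply: eq_bigl => v; rewrite !inE andbA andbb.
  rewrite -big_split; apply: leq_sum => v vY /=; rewrite !inE vY /=.
  by case: ifP => // _; rewrite addn0; apply/leq_card_down/tallY.
have := max_card (mem Y); nia.
Qed.

(** Averaging: each good vertex is tall, hence has at least [m] descendants within distance [m]; by
    double counting, some [w] has at least the average number of good ancestors. *)
Lemma exists_many_good_ancestors (Bad : {set V}) m : (forall v, v \notin Bad -> tall m v) ->
  0 < #|V| -> exists w, m * (#|V| - #|Bad|) <= #|V| * count [pred v | v \notin Bad] (up m w).
Proof.
move=> tallB V0.
have total : m * (#|V| - #|Bad|) <= \sum_u count [pred v | v \notin Bad] (up m u).
  rewrite -sum_card_down.
  have -> : #|V| - #|Bad| = #|~: Bad| by rewrite -(cardsC Bad) addKn.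
  rewrite mulnC -sum_nat_const.
  have -> : \sum_(v in ~: Bad) m = \sum_(v | [pred v | v \notin Bad] v) m by apply: eq_bigl => v; rewrite !inE.
  by apply: leq_sum => v vB; apply/leq_card_down/tallB.
have /card_gt0P[v0 _] := V0.
case: (@arg_maxnP _ v0 xpredT (fun w => count [pred v | v \notin Bad] (up m w)) isT) => w _ w_max.
exists w; apply: leq_trans total _; rewrite -sum_nat_const; apply: leq_sum => u _.
exact: w_max.
Qed.

End Forest.

(** * Depth-first search *)

Section DepthFirstSearch.
Variable G : sgraph.
Implicit Types (F : {set {set G}}) (u v w x y : G).

(** [anc] maps a visited vertex to the stack right after its visit, which is its path to the root;
    [fresh] holds the unvisited vertices. *)
Record dfs_state := DfsState {
  stack : seq G; fresh : {set G}; tested : {set {set G}}; anc : G -> seq G }.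

Definition visit u st := DfsState (u :: stack st) (fresh st :\ u) (tested st)
  (fun v => if v == u then u :: stack st else anc st v).

Definition test e st := DfsState (stack st) (fresh st) (e |: tested st) (anc st).

Definition pop st := DfsState (behead (stack st)) (fresh st) (tested st) (anc st).

Definition dfs_step F st :=
  if stack st is v :: _ then
    if [pick u in fresh st | adj v u && ([set v; u] \notin tested st)] is Some u then
      if [set v; u] \in F then visit u (test [set v; u] st) else test [set v; u] st
    else pop st
  else if [pick u in fresh st] is Some u then visit u st else st.

Definition dfs_init := DfsState [::] setT set0 (fun=> [::]).

(* Every step that changes the state decreases [dfs_todo] below, whose initial
   value is this number of iterations. *)
Definition dfs_run F := iter (2 * #|G| + #|{set G}|) (dfs_step F) dfs_init.

(* The two runs agree until e is tested. *)
Lemma dfs_tested_setU1 F (e : {set G}) :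
  (e \in tested (dfs_run (e |: F))) = (e \in tested (dfs_run (F :\ e))).
Proof.
have tested_step F' st : e \in tested st -> e \in tested (dfs_step F' st).
  rewrite /dfs_step; case: (stack st) => [|v s]; first by case: pickP.
  by case: pickP => // u _ et; case: ifP => _ /=; rewrite inE et orbT.
rewrite /dfs_run; set f := dfs_step (e |: F); set g := dfs_step (F :\ e).
suff: forall n, iter n f dfs_init = iter n g dfs_init \/
    (e \in tested (iter n f dfs_init)) && (e \in tested (iter n g dfs_init)).
  by move=> /(_ (2 * #|G| + #|{set G}|)%N)[->//|/andP[-> ->]].
elim=> [|n [IH|/andP[ef eg]]]; first by left.
  rewrite !iterS -IH; set st := iter n f dfs_init.
  rewrite /f /g /dfs_step; case: (stack st) => [|v s]; first by left.
  case: pickP => [u _|]; last by left.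
  (* [pick] looks only at the state, so both runs test the same edge, and the two edge sets disagree
     only about [e]. *)
  rewrite !inE; case: (eqVneq [set v; u] e) => [->|ne] /=; last by left.
  by right; rewrite !inE eqxx.
by right; rewrite !iterS !tested_step.
Qed.

(** [tested_done] keeps [untested_vertical] true: when [y] is visited, earlier vertices off the
    stack already have their edges to [y] tested, and the stack becomes the ancestor list of [y]. *)
Record dfs_inv F st : Prop := DfsInv {
  stack_anc : forall l w s, stack st = l ++ w :: s ->
    w \notin fresh st /\ anc st w = w :: s;
  anc_visited : forall v, v \notin fresh st ->
    [/\ exists s, anc st v = v :: s, uniq (anc st v),
        sorted (span_adj F) (anc st v) & {in anc st v, forall w, w \notin fresh st}];
  anc_suffix : forall v l w s, v \notin fresh st ->
    anc st v = l ++ w :: s -> anc st w = w :: s;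
  tested_done : forall x y, x \notin fresh st -> x \notin stack st -> y \in fresh st ->
    adj x y -> [set x; y] \in tested st;
  untested_vertical : forall x y, x \notin fresh st -> y \notin fresh st -> adj x y ->
    [set x; y] \notin tested st -> (x \in anc st y) || (y \in anc st x) }.

Lemma dfs_inv_test F st e : dfs_inv F st -> dfs_inv F (test e st).
Proof.
case=> i1 i2 i3 i4 i5; split=> //= x y xf yf.
  by move=> yf' xy; rewrite inE i4 ?orbT.
by move=> xy; rewrite inE negb_or => /andP[_]; apply: i5.
Qed.

Lemma dfs_inv_pop F st v s : stack st = v :: s ->
  (forall u, u \in fresh st -> adj v u -> [set v; u] \in tested st) ->
  dfs_inv F st -> dfs_inv F (pop st).
Proof.
move=> es noadj [i1 i2 i3 i4 i5]; rewrite /pop es; split=> //= [l w s' el|x y xf xs].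
  by apply: (i1 (v :: l)); rewrite es el.
have [->|xv] := eqVneq x v; first exact: noadj.
by apply: i4 => //; rewrite es inE negb_or xv.
Qed.

Lemma dfs_inv_visit F st u : u \in fresh st ->
  (if stack st is v :: _ then span_adj F v u else true) ->
  dfs_inv F st -> dfs_inv F (visit u st).
Proof.
move=> uf su [i1 i2 i3 i4 i5].
have ne_u v : v \notin fresh st -> v == u = false.
  by move=> vf; apply/negbTE; apply: contraNneq vf => ->.
have stack_visited v : v \in stack st -> v \notin fresh st.
  by move=> vs; case/splitPr es : _ / vs => [l s]; case: (i1 l v s).
have freshN v : v != u -> v \notin fresh st :\ u -> v \notin fresh st.
  by move=> vu; rewrite !inE vu.
have I1 l w s : u :: stack st = l ++ w :: s ->
    w \notin fresh st :\ u /\ (if w == u then u :: stack st else anc st w) = w :: s.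
  case: l => [[<- <-]|a l [_ el]]; first by rewrite eqxx !inE eqxx.
  by have [wf ->] := i1 _ _ _ el; rewrite ne_u // !inE (negbTE wf) andbF.
split=> //= [v vf|v l w s vf|x y xf|x y xf yf xy].
- have [->|vu] := eqVneq v u; last first.
    have [? ? ? anc_vis] := i2 v (freshN _ vu vf); split=> // w /anc_vis wf.
    by rewrite !inE (negbTE wf) andbF.
  have us : u \notin stack st by apply: contraL uf => /stack_visited.
  split=> [|||w]; first by exists (stack st).
  + rewrite /= us; case es: (stack st) => [//|a s].
    by have [/i2[_ ua _ _] ea] := i1 [::] a s es; rewrite -ea.
  + rewrite /=; case es: (stack st) su => [//|a s] /= su.
    have [/i2[_ _ sa _] ea] := i1 [::] a s es.
    by rewrite ea in sa; rewrite span_adj_sym su.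
  + rewrite !inE => /orP[->//|ws]; by rewrite (negbTE (stack_visited _ ws)) andbF.
- have [_|vu] := eqVneq v u; first by move/I1 => [].
  move=> ev; have vf' := freshN _ vu vf; have [_ _ _ anc_vis] := i2 v vf'.
  rewrite ne_u; first exact: i3 ev.
  by apply: anc_vis; rewrite ev mem_cat mem_head orbT.
- rewrite !inE negb_or => /andP[xu xs] /andP[yu yf]; apply: i4 => //.
  exact: freshN.
- have [eyu|yu] := eqVneq y u; have [exu|xu] := eqVneq x u.
  + by move: xy; rewrite eyu exu adj_irrefl.
  + rewrite inE; have [xs|xs] := boolP (x \in stack st); first by rewrite orbT.
    by rewrite eyu i4 ?freshN // -eyu.
  + rewrite inE; have [ys|ys] := boolP (y \in stack st); first by rewrite !orbT.
    by rewrite setUC exu i4 ?freshN // adj_sym -exu.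
  + by apply: i5; rewrite ?freshN.
Qed.

Lemma dfs_inv_step F st : dfs_inv F st -> dfs_inv F (dfs_step F st).
Proof.
move=> inv; rewrite /dfs_step; case es: (stack st) => [|v s].
  by case: pickP => // u uf; apply: dfs_inv_visit; rewrite ?es.
case: pickP => [u /and3P[uf vu _]|none].
  case: ifP => eF; last exact: dfs_inv_test.
  apply: dfs_inv_visit => //=; first by rewrite es /span_adj /= vu eF.
  exact: dfs_inv_test.
apply: dfs_inv_pop es _ inv => u uf vu; apply/negPn/negP => nt.
by have := none u; rewrite uf vu nt.
Qed.

Lemma dfs_inv_init F : dfs_inv F dfs_init.
Proof. by split=> [[]|v|v l w s|x y|x y] //=; rewrite inE. Qed.

(** A fresh vertex counts twice, for its visit and for its later pop. *)
Definition dfs_todo st := 2 * #|fresh st| + size (stack st) + #|~: tested st|.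

Lemma dfs_todo_step F st : (dfs_todo (dfs_step F st)).+1 <= dfs_todo st \/
  stack st = [::] /\ fresh st = set0.
Proof.
have D1 u : u \in fresh st -> #|fresh st| = #|fresh st :\ u|.+1.
  by move=> uf; rewrite (cardsD1 u) uf.
have D2 e : e \notin tested st -> #|~: tested st| = #|~: (e |: tested st)|.+1.
  move=> eN; rewrite (cardsD1 e) inE eN setCU; congr _.+1.
  by apply: eq_card => f; rewrite !inE.
rewrite /dfs_todo /dfs_step; case es: (stack st) => [|v s].
  case: pickP => [u uf|none]; last by right; split=> //; apply/setP => u; rewrite inE;
    apply: none.
  by left; rewrite /= es /= (D1 _ uf); lia.
left; case: pickP => [u /and3P[uf _ et]|_]; last by rewrite /= es /=; lia.
by rewrite (D2 _ et) (D1 _ uf); case: ifP => _ /=; rewrite es /= ?(D1 _ uf); lia.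
Qed.

Lemma dfs_finished F : fresh (dfs_run F) = set0.
Proof.
have done_step st : stack st = [::] -> fresh st = set0 -> dfs_step F st = st.
  by rewrite /dfs_step => -> ->; case: pickP => // u; rewrite inE.
have progress n : dfs_todo (iter n (dfs_step F) dfs_init) + n <= dfs_todo dfs_init \/
    stack (iter n (dfs_step F) dfs_init) = [::] /\ fresh (iter n (dfs_step F) dfs_init) = set0.
  elim: n => [|n [IH|[s0 f0]]]; first by left; rewrite addn0.
    rewrite iterS; have [h|[s0 f0]] := dfs_todo_step F (iter n (dfs_step F) dfs_init);
      last by right; rewrite done_step.
    by left; lia.
  by right; rewrite iterS done_step.
have [|[_ ->//]] := progress (2 * #|G| + #|{set G}|)%N.
rewrite /dfs_todo {2}/dfs_init /= setC0 !cardsT addn0 -/(dfs_run F) => h.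
have arith a b c m : 2 * a + b + c + m <= m -> a = 0 by lia.
by apply/eqP; rewrite -cards_eq0; apply/eqP/(arith _ _ _ _ h).
Qed.

Lemma dfs_invP F : dfs_inv F (dfs_run F).
Proof.
by rewrite /dfs_run; elim: (2 * _ + _)%N => [|n IH]; [exact: dfs_inv_init|rewrite iterS;
  exact: dfs_inv_step].
Qed.

Lemma dfs_tested_edges F : tested (dfs_run F) \subset edges G.
Proof.
rewrite /dfs_run; elim: (2 * _ + _)%N => [|n IH]; first exact: sub0set.
rewrite iterS; move: IH; set st := iter _ _ _; rewrite /dfs_step => IH.
case: (stack st) => [|v s]; first by case: pickP.
case: pickP => [u /and3P[_ vu _]|//].
have {}IH : [set v; u] |: tested st \subset edges G.
  by rewrite subUset sub1set IH andbT; apply/imsetP; exists (v, u); rewrite ?inE.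
by case: ifP.
Qed.

(* Each successful test makes a new vertex visited. *)
Lemma card_dfs_testedI F : #|tested (dfs_run F) :&: F| <= #|G|.
Proof.
suff: #|tested (dfs_run F) :&: F| <= #|~: fresh (dfs_run F)|.
  by move=> h; apply: leq_trans h (max_card _).
rewrite /dfs_run; elim: (2 * _ + _)%N => [|n IH]; first by rewrite set0I cards0.
rewrite iterS; move: IH; set st := iter _ _ _; rewrite /dfs_step => IH.
have D1 u : u \in fresh st -> #|~: (fresh st :\ u)| = #|~: fresh st|.+1.
  move=> uf; rewrite (cardsD1 u) !inE eqxx /=; congr _.+1.
  by apply: eq_card => x; rewrite !inE; case: (eqVneq x u) => [->|//]; rewrite uf.
case: (stack st) => [|v s].
  by case: pickP => [u uf|//]; rewrite /= D1 // leqW.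
case: pickP => [u /and3P[uf _ _]|//]; case: ifP => eF /=.
  rewrite D1 // setIUl; apply: leq_trans (leq_card_setU _ _) _.
  by rewrite -addn1 addnC leq_add // (leq_trans (subset_leq_card (subsetIl _ _))) ?cards1.
rewrite setIUl; have -> : [set [set v; u]] :&: F = set0; last by rewrite set0U.
by apply/setP => f; rewrite !inE; case: eqVneq => // ->; rewrite eF.
Qed.

End DepthFirstSearch.

(** * Chords of the search forest *)

(** A block missed by [a] would leave at most [m - b] hits among the first [m] entries. *)
Lemma nonempty_block (T : Type) (x0 : T) (a : pred T) s m b j :
  m < count a (take m s) + b -> j.+1 * b <= m ->
  exists i, [/\ j * b <= i < j.+1 * b, i < size s & a (nth x0 s i)].
Proof.
move=> many jm; set t := take b (drop (j * b) s).
have has_t : has a t.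
  apply: contraLR many => /negbTE none; rewrite -leqNgt.
  have -> : m = j * b + (b + (m - j.+1 * b)) by nia.
  have c0 : count a t = 0 by apply/eqP; rewrite -leqn0 leqNgt -has_count none.
  rewrite takeD count_cat takeD count_cat -/t c0 add0n.
  have le_take n t' : count a (take n t') <= n.
    by rewrite (leq_trans (count_size _ _)) // size_take_min geq_minl.
  by have := le_take (j * b) s; have := le_take (m - j.+1 * b) (drop b (drop (j * b) s)); lia.
have := has_t; rewrite has_find => lt_find; have := nth_find x0 has_t.
set l := find a t in lt_find *; move: lt_find; rewrite /t size_take_min size_drop => lt_find.
rewrite nth_take ?nth_drop; last by lia.
by exists (j * b + l); split=> //; lia.
Qed.

Lemma card_imset_pair (T : finType) (v : T) (N : {set T}) : v \notin N ->
  #|[set [set v; u] | u in N]| = #|N|.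
Proof.
move=> vN; apply: card_in_imset => x y xN yN /setP exy.
have := exy x; rewrite !inE eqxx orbT => /esym/orP[/eqP xv|/eqP//].
by move: vN; rewrite -xv xN.
Qed.

Lemma card_edge (G : sgraph) (f : {set G}) : f \in edges G -> #|f| = 2.
Proof.
case/imsetP=> -[x y] xy ->; move: xy; rewrite inE /= => xy.
by rewrite cards2; case: eqVneq xy => // ->; rewrite adj_irrefl.
Qed.

(** Handshake count: each edge of [Q] is seen from its two ends. *)
Lemma sum_card_incident (G : sgraph) (Q : {set {set G}}) : Q \subset edges G ->
  \sum_v #|[set y | adj v y & [set v; y] \in Q]| <= 2 * #|Q|.
Proof.
move=> /subsetP sQE.
have -> : 2 * #|Q| = \sum_(v : G) \sum_(f in Q) (v \in f : nat).
  rewrite exchange_big mulnC -sum_nat_const; apply: eq_bigr => f fQ /=.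
  by rewrite -(card_edge (sQE f fQ)) -sum1_card big_mkcond; apply: eq_bigr => v _; case:
    (v \in f).
apply: leq_sum => v _.
rewrite -(@card_imset_pair _ v); last by rewrite inE adj_irrefl.
rewrite -big_mkcondr sum1_card /=; apply: subset_leq_card; apply/subsetP => f.
by move=> /imsetP[y]; rewrite inE => /andP[_ vyQ] ->; rewrite unfold_in vyQ !inE eqxx.
Qed.

Lemma open_ladder_cycle (H : sgraph) (w : H) (P : seq H) x y c : uniq P ->
  open_ladder (fun i j => adj (nth w P i) (nth w P j)) (size P) x y c ->
  sorted (@adj H) P -> 2 < size c + (y - x) ->
  exists c' : seq H, is_cycle c' /\ size c' = size c + (y - x).
Proof.
move=> uP lad /(sortedP w) sP long.
have [|z sz [cz uz /allP zP]] := open_ladder_close _ lad; first exact: sP.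
exists (map (nth w P) z); rewrite size_map sz; split=> //; split; first by rewrite size_map sz.
apply/andP; split; first by rewrite cycle_map.
rewrite map_inj_in_uniq // => i j /zP /= iP /zP /= jP /eqP.
by rewrite nth_uniq // => /eqP.
Qed.

Lemma chord_cycle (H : sgraph) (P : seq H) v u : uniq (v :: P) ->
  sorted (@adj H) (v :: P) -> u \in P -> adj v u -> 1 < index u (v :: P) ->
  exists c : seq H, is_cycle c /\ size c = (index u (v :: P)).+1.
Proof.
move=> uP sP uInP vu long;
  have iL : index u (v :: P) < size (v :: P) by rewrite index_mem inE uInP orbT.
have lad : open_ladder (fun i j => adj (nth v (v :: P) i) (nth v (v :: P) j))
    (size (v :: P)) 0 (index u (v :: P)) [:: 0].
  apply: open_ladder_chord; first by move=> i j; rewrite adj_sym.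
    by rewrite iL andbT ltnW.
  by rewrite nth_index // inE uInP orbT.
have [|c [cyc sc]] := open_ladder_cycle uP lad sP; first by rewrite subn0.
by exists c; split=> //; rewrite sc subn0.
Qed.

(** Here [s], [y1], [y], [h] are the sizes of [S], [Y :\: S], [Y], [H :\: Y] defined below. The
    hypotheses give [s * Z <= 4 * q * n], [y <= s * (1 + M)] and [h <= 2 * q * y]; [Z] is chosen
    just large enough to absorb these factors and [M]. *)
Lemma bad_count_arith n k b q M Z Qn s y y1 h d :
  0 < b -> k <= 20 * q * b -> d <= k ->
  Z = (4 * q * (1 + (1 + 2 * q) * (1 + M)) * M).+1 -> 0 < n ->
  Qn * Z <= n * k -> 10 * b * s <= 2 * Qn ->
  20 * b * y1 <= M * b * s -> y <= y1 + s -> 10 * b * h <= d * y ->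
  (s + y + h) * M < n.
Proof.
move=> b0 kb dk eZ n0 QZ sQ y1s yy1 hy.
have sZ : s * Z <= 4 * q * n.
  have b10 : 0 < 10 * b by rewrite muln_gt0.
  rewrite -(leq_pmul2l b10) mulnA.
  apply: leq_trans (leq_mul sQ (leqnn Z)) _.
  rewrite -mulnA; apply: leq_trans (leq_mul (leqnn 2) QZ) _.
  apply: leq_trans (leq_mul (leqnn 2) (leq_mul (leqnn n) kb)) _.
  by clear; lia.
have ys : y <= s * (1 + M).
  have : y1 <= M * s.
    rewrite -(leq_pmul2l b0); apply: leq_trans (_ : M * b * s <= _); last by clear; lia.
    by apply: leq_trans y1s; clear; lia.
  by move: yy1; clear; lia.
have hq : h <= 2 * q * y.
  have b10 : 0 < 10 * b by rewrite muln_gt0.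
  rewrite -(leq_pmul2l b10); apply: leq_trans hy _.
  apply: leq_trans (leq_mul (leq_trans dk kb) (leqnn y)) _.
  by clear; lia.
set W := 1 + (1 + 2 * q) * (1 + M) in eZ *.
have bad_le : s + y + h <= s * W.
  have h2 := leq_mul (leqnn (1 + 2 * q)) ys.
  rewrite /W; move: hq h2; clear; lia.
have Z0 : 0 < Z by rewrite eZ.
rewrite -(ltn_pmul2r Z0).
apply: leq_ltn_trans (_ : 4 * q * W * M * n < _); last first.
  by rewrite eZ mulnC ltn_pmul2l.
apply: leq_trans (leq_mul (leq_mul bad_le (leqnn M)) (leqnn Z)) _.
apply: leq_trans (_ : W * M * (s * Z) <= _); first by clear; lia.
apply: leq_trans (leq_mul (leqnn (W * M)) sZ) _; by clear; lia.
Qed.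

Lemma many_good_arith n m M b X c : 0 < b -> m = M * b -> X <= n -> X * M < n ->
  m * (n - X) <= n * c -> n * m < n * (c + b).
Proof.
move=> b0 -> Xn XM; rewrite mulnBr mulnDr.
have := XM; rewrite -(ltn_pmul2r b0); clear; lia.
Qed.

Section SearchForest.
Variables (G : sgraph) (F Q : {set {set G}}) (anc : G -> seq G).
Hypothesis anc_self : forall v, exists s, anc v = v :: s.
Hypothesis anc_suffix : forall v l w s, anc v = l ++ w :: s -> anc w = w :: s.
Hypothesis anc_uniq : forall v, uniq (anc v).
Hypothesis anc_sorted : forall v, sorted (span_adj F) (anc v).
Hypothesis Q_edges : Q \subset edges G.
Hypothesis vertical : forall x y, adj x y -> [set x; y] \notin Q ->
  (x \in anc y) || (y \in anc x).
Implicit Types (v u x y : G) (d : nat) (F : {set {set G}}).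

Definition tested_nbr v := [set y | adj v y & [set v; y] \in Q].
Definition up_nbr d v := [set y in up anc d v | adj v y].
Definition far_nbr d v := [set y | adj v y &
  (y \in anc v) && (d < index y (anc v)) || (v \in anc y) && (d < index v (anc y))].

Lemma index_anc_gt0 v u : u != v -> 0 < index u (anc v).
Proof. by have [s ->] := anc_self v; rewrite /= eq_sym => /negbTE ->. Qed.

(** An untested edge is vertical, so its other end is a descendant or an ancestor, near or far. *)
Lemma degree_split d v :
  degree v <= #|tested_nbr v| + #|down anc d v| + #|up_nbr d v| + #|far_nbr d v|.
Proof.
apply: leq_trans (_ : #|tested_nbr v :|: down anc d v :|: up_nbr d v :|: far_nbr d v| <= _);
  last first.
  do 2 (apply: leq_trans (leq_card_setU _ _) _; rewrite leq_add2r).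
  exact: leq_card_setU.
apply: subset_leq_card; apply/subsetP => y; rewrite !inE => vy; rewrite vy /=.
have [//|vyQ] := boolP ([set v; y] \in Q); rewrite /= andbT !mem_up //.
have vNy : v != y by apply: contraTneq vy => ->; rewrite adj_irrefl.
have i1 := index_anc_gt0 vNy; have i2 : 0 < index y (anc v) by rewrite index_anc_gt0 // eq_sym.
rewrite i1 i2 /=; have /orP[->|->] /= := vertical vy vyQ.
  by rewrite [_ < index v _]ltnNge; case: (index v _ <= d); rewrite /= ?orbT.
by rewrite [_ < index y _]ltnNge; case: (index y _ <= d); rewrite /= ?orbT.
Qed.

Lemma span_adjUl F2 : subrel (span_adj F) (@adj (spanning_subgraph (F :|: F2))).
Proof. by move=> x y /andP[xy xyF]; rewrite /= /span_adj /= xy inE xyF. Qed.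

Lemma span_adjUr F2 x y : adj x y -> [set x; y] \in F2 ->
  @adj (spanning_subgraph (F :|: F2)) x y.
Proof. by move=> xy xyF; rewrite /= /span_adj /= xy inE xyF orbT. Qed.

(** The forest path from [v] up to [u] uses edges of [F], and the edge in [F2] closes it. *)
Lemma cycle_of_up_edge F2 d v u : 0 < d -> adj v u -> [set v; u] \in F2 ->
  u \in anc v -> d < index u (anc v) ->
  exists c : seq (spanning_subgraph (F :|: F2)), is_cycle c /\ d <= size c.
Proof.
move=> d0 vu vuF uv long; have [s ev] := anc_self v.
have us : u \in s.
  by move: uv long; rewrite ev inE /= => /orP[/eqP->|//]; rewrite eqxx.
have /= sv := anc_sorted v; have uv' := anc_uniq v; rewrite ev in sv uv' long.
have [|c [cyc sc]] :=
  @chord_cycle (spanning_subgraph (F :|: F2)) _ _ _ uv' (sub_sorted (@span_adjUl F2) sv) us (span_adjUr vu vuF).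
  exact: leq_ltn_trans d0 long.
by exists c; split=> //; rewrite sc leqW // ltnW.
Qed.

Lemma cycle_of_far_edge F2 d v u : 0 < d -> u \in far_nbr d v -> [set v; u] \in F2 ->
  exists c : seq (spanning_subgraph (F :|: F2)), is_cycle c /\ d <= size c.
Proof.
move=> d0; rewrite inE => /andP[vu /orP[]/andP[anc_vu long]] vuF.
  exact: cycle_of_up_edge d0 vu vuF anc_vu long.
rewrite adj_sym in vu; rewrite setUC in vuF.
exact: cycle_of_up_edge d0 vu vuF anc_vu long.
Qed.

(** Markov's inequality for the tested degrees. *)
Lemma card_tested_large e : e * #|[set v | e < #|tested_nbr v|]| <= 2 * #|Q|.
Proof.
apply: leq_trans (sum_card_incident Q_edges).
rewrite [X in _ <= X](bigID (fun v => e < #|tested_nbr v|)) /= mulnC -sum_nat_const.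
apply: leq_trans (leq_addr _ _).
under eq_bigl => v do rewrite inE.
by apply: leq_sum => v /ltnW.
Qed.

Lemma imset_pair_edges v (N : {set G}) : (forall u, u \in N -> adj v u) ->
  [set [set v; u] | u in N] \subset edges G.
Proof.
move=> adjN; apply/subsetP => f /imsetP[u uN ->].
by apply/imsetP; exists (v, u); rewrite // inE /= adjN.
Qed.

(** * Bad vertices and the chord family *)

Section Counting.
Variables (k b q : nat).
(** As [k <= N * b], a gain of [b] for each of [N] chords yields length [k]. The [M] blocks of
    length [b] span the [N.+1 * k] positions that such a chain may need. *)
Let N := 20 * q.
Let M := N * N.+1.
(** At a vertex that is not bad, the slack [40 * b] pays for [10 * b] tested edges, [10 * b] far
    ones and [10 * b] surplus descendants, and leaves [10 * b] edges to near ancestors. *)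
Let d := k - 40 * b.
Hypotheses (q_ge : 8 <= q) (b_gt0 : 0 < b) (qb_le : 10 * q * b <= k)
  (k_lt : k <= 20 * q * b).
Hypothesis min_deg : forall v : G, k <= degree v.
Hypothesis V_gt0 : 0 < #|G|.
Hypothesis Q_small : #|Q| * (4 * q * (1 + (1 + 2 * q) * (1 + M)) * M).+1 <= #|G| * k.
Hypothesis no_far : forall v, #|far_nbr d v| < 10 * b.

Let S := [set v | 10 * b < #|tested_nbr v|].
Let Y := [set v | ~~ tall anc (M * b) v].
Let H := [set v | d + 10 * b <= #|down anc d v|].

Lemma card_up_le m v : #|up_nbr m v| <= m.
Proof.
apply: leq_trans (size_up anc m v); rewrite -(card_uniqP (uniq_up anc_uniq m v)).
by apply: subset_leq_card; apply/subsetP => y; rewrite inE => /andP[].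
Qed.

Lemma leq_40b_k : 40 * b <= k.
Proof. by apply: leq_trans qb_le; rewrite leq_mul2r; move: q_ge; clear; lia. Qed.

Lemma leq_d_m : d <= M * b.
Proof.
apply: leq_trans (leq_subr _ _) _; apply: leq_trans k_lt _.
by rewrite leq_mul2r leq_pmulr // orbT.
Qed.

Lemma leq_card_down_small v : v \notin S -> 20 * b <= #|down anc d v|.
Proof.
rewrite inE -leqNgt => vS.
move: (degree_split d v) (min_deg v) (no_far v) (card_up_le d v) vS leq_40b_k.
rewrite /d; clear; lia.
Qed.

Lemma leq_card_up_nbr v : v \notin S :|: Y :|: H -> 10 * b <= #|up_nbr d v|.
Proof.
rewrite !inE !negb_or -leqNgt -ltnNge => /andP[/andP[vS _] vH].
move: (degree_split d v) (min_deg v) (no_far v) vS vH leq_40b_k.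
rewrite /d; clear; lia.
Qed.

(** [S] is small because few edges are tested; [card_not_tall] bounds [Y] in terms of [S], and
    [card_heavy] bounds the rest of [H] in terms of [Y]. *)
Lemma card_bad_lt : #|S :|: Y :|: H| * M < #|G|.
Proof.
have cS : 10 * b * #|S| <= 2 * #|Q| := card_tested_large _.
have cY : 20 * b * #|Y :\: S| <= M * b * #|S|.
  by apply: (card_not_tall anc_self anc_suffix anc_uniq leq_d_m) => v;
    apply: leq_card_down_small.
have cH : 10 * b * #|H :\: Y| <= d * #|Y|.
  apply: (card_heavy anc_self anc_suffix anc_uniq) => v; rewrite inE negbK.
  exact: leq_tall leq_d_m.
have Y_le : #|Y| <= #|Y :\: S| + #|S|.
  apply: leq_trans (leq_card_setU _ _); apply: subset_leq_card; apply/subsetP => v.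
  by rewrite !inE => ->; rewrite andbT orNb.
have bad_le : #|S :|: Y :|: H| <= #|S| + #|Y| + #|H :\: Y|.
  apply: leq_trans (_ : #|S :|: Y :|: (H :\: Y)| <= _).
    apply: subset_leq_card; apply/subsetP => v; rewrite !inE.
    by case: (_ < _) => //=; case: (tall _ _ _) => //=.
  apply: leq_trans (leq_card_setU _ _) _; rewrite leq_add2r; exact: leq_card_setU.
apply: leq_ltn_trans (_ : (#|S| + #|Y| + #|H :\: Y|) * M < _);
  first by rewrite leq_mul2r bad_le orbT.
exact: (bad_count_arith b_gt0 k_lt (leq_subr _ _) (erefl _) V_gt0 Q_small cS cY Y_le cH).
Qed.

(** [B j] consists of upward edges at a good vertex in block [j] of an ancestor line that is good at
    all but fewer than [b] of its [M * b] positions. *)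
Lemma exists_chord_family : exists B : 'I_M -> {set {set G}},
  (forall j, B j \subset edges G /\ 5 * b <= #|B j|) /\
  forall F2, (forall j, ~~ [disjoint F2 & B j]) ->
    exists c : seq (spanning_subgraph (F :|: F2)), is_cycle c /\ d <= size c.
Proof.
have [|w w_good] := @exists_many_good_ancestors _ _ anc_self anc_suffix anc_uniq (S :|: Y :|: H) (M * b) _ V_gt0.
  by move=> v; rewrite !inE !negb_or negbK => /andP[/andP[]].
have {}w_good : M * b < count [pred v | v \notin S :|: Y :|: H] (up anc (M * b) w) + b.
  rewrite -(ltn_pmul2l V_gt0).
  exact: many_good_arith b_gt0 (erefl _) (max_card _) card_bad_lt w_good.
set P := behead (anc w); have [s ew] := anc_self w.
have eP : anc w = w :: P by rewrite /P ew.
have block (j : 'I_M) : exists i, [/\ j * b <= i < j.+1 * b, i < size P & nth w P i \notin S :|: Y :|: H].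
  apply: (nonempty_block w w_good); rewrite leq_mul2r; apply/orP; right; exact: ltn_ord.
have {block}[i iP] := fin_all_exists block.
(* Chords shorter than [5 * b] are dropped, as the ladder needs long ones; this costs at most
   [5 * b] of the [10 * b] upward edges. *)
pose N' j := [set u in up_nbr d (nth w P (i j)) | 5 * b <= index u (anc (nth w P (i j)))].
have adjN' j u : u \in N' j -> adj (nth w P (i j)) u by rewrite !inE => /andP[/andP[]].
exists (fun j => [set [set nth w P (i j); u] | u in N' j]); split=> [j|F2 hit].
  split; first by apply: imset_pair_edges => u; apply: adjN'.
  have [_ _ good] := iP j; set x := nth w P (i j) in good *.
  rewrite card_imset_pair; last by apply/negP => /adjN'; rewrite adj_irrefl.
  have sub : up_nbr d x \subset N' j :|: up_nbr (5 * b) x.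
    apply/subsetP => u ux; rewrite inE [u \in N' j]inE ux /=.
    case: leqP => //= lt5; move: ux; rewrite !inE !mem_up // => /andP[/and3P[-> -> _] ->].
    by rewrite ltnW.
  rewrite -(leq_add2r (5 * b)) -mulnDl; apply: leq_trans (leq_card_up_nbr good) _.
  apply: leq_trans (subset_leq_card sub) (leq_trans (leq_card_setU _ _) _).
  by rewrite leq_add2l card_up_le.
have uP : uniq P by have := anc_uniq w; rewrite eP => /andP[].
have sP : sorted (@adj (spanning_subgraph (F :|: F2))) P.
  apply: sub_sorted (@span_adjUl F2) _ _; have := anc_sorted w; rewrite eP.
  exact: path_sorted.
pose r i j := @adj (spanning_subgraph (F :|: F2)) (nth w P i) (nth w P j).
have chord j : j < M -> exists s t,
    [/\ j * b <= s < j.+1 * b, s + 5 * b <= t <= s + k, t < size P & r s t].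
  move=> jM; have [jb iL _] := iP (Ordinal jM); have := hit (Ordinal jM).
  rewrite -setI_eq0 => /set0Pn[f /setIP[fF2 /imsetP[u uN ef]]].
  move: uN (adjN' _ _ uN) jb iL ef; set x := nth w P _; set l := i _ => uN xu jb iL ef.
  (* Hence the ancestor of index [i] above [x] has position [l + i] on [P]. *)
  have ex : anc x = drop l P.
    have := drop_nth w iL; rewrite -/x => eD; rewrite eD.
    by apply: (anc_suffix (v := w) (l := w :: take l P)); rewrite eP -eD /= cat_take_drop.
  move: uN; rewrite !inE mem_up // ex => /andP[/andP[/and3P[ux _ ud] _] lb].
  exists l, (l + index u (drop l P)); split=> //.
  - by rewrite leq_add2l lb leq_add2l (leq_trans ud) // leq_subr.
  - by move: ux; rewrite -index_mem size_drop ltn_subRL.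
  - by rewrite /r -nth_drop nth_index //; apply: span_adjUr; rewrite -?ef.
have r_sym : symmetric r by move=> ? ?; rewrite /r adj_sym.
have r_succ l : l.+1 < size P -> r l l.+1 by apply/sortedP.
have bk : 0 < b <= k.
  by rewrite b_gt0; apply: leq_trans qb_le; rewrite leq_pmull // muln_gt0 /= (leq_trans _ q_ge).
have NM : N.+1 * k <= M * b by rewrite /M [N * _]mulnC -mulnA leq_mul2l k_lt.
have [x [y [c [lad hy hc]]]] := chords_open_ladder r_sym r_succ bk NM chord.
have [|cyc [cyc_ok cyc_size]] :=
  @open_ladder_cycle (spanning_subgraph (F :|: F2)) w P _ _ _ uP lad sP;
    first by move: hy b_gt0; clear; lia.
exists cyc; split=> //; rewrite cyc_size; apply: leq_trans hc.
exact: leq_trans (leq_subr _ _) k_lt.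
Qed.

End Counting.
End SearchForest.

(** Rounding a quotient down to a positive integer costs at most a factor 2. *)
Lemma leq_double_divn k q : 0 < k %/ (10 * q) -> k <= 20 * q * (k %/ (10 * q)).
Proof.
move=> b0; have q10 : 0 < 10 * q by rewrite lt0n; apply: contraTneq b0 => ->; rewrite divn0.
set b := k %/ _ in b0 *; apply: ltnW (leq_trans (ltn_ceil k q10) _); rewrite -/b.
apply: leq_trans (_ : (b + b) * (10 * q) <= _);
  first by rewrite leq_mul2r -[b.+1]addn1 leq_add2l b0 orbT.
by clear; lia.
Qed.

(* The family is a constant one when a single vertex has many far neighbours.
   Otherwise the factor of the tested edges keeps the unsuitable vertices below
   |G|/M, so that some line of M * b ancestors has fewer than b of them. *)
Lemma exists_hitting_family (G : sgraph) (F : {set {set G}}) k q :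
  let b := k %/ (10 * q) in let M := 20 * q * (20 * q).+1 in
  8 <= q -> 0 < b -> min_degree_at_least G k ->
  #|tested (dfs_run F)| * (4 * q * (1 + (1 + 2 * q) * (1 + M)) * M).+1 <= #|G| * k ->
  exists B : 'I_M -> {set {set G}},
  (forall j, B j \subset edges G /\ 5 * b <= #|B j|) /\
  forall F2 : {set {set G}}, (forall j, ~~ [disjoint F2 & B j]) ->
    exists c : seq (spanning_subgraph (F :|: F2)), is_cycle c /\ k - 40 * b <= size c.
Proof.
move=> b M q8 b0 [V0 min_deg] Q_small; have := dfs_invP F; set st :=
  dfs_run F in Q_small * => inv.
have vis v : v \notin fresh st by rewrite dfs_finished inE.
have a_self v := let: And4 h _ _ _ := anc_visited inv (vis v) in h.
have a_uniq v : uniq (anc st v) by have [] := anc_visited inv (vis v).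
have a_sorted v : sorted (span_adj F) (anc st v) by have [] := anc_visited inv (vis v).
have a_suffix v l w s : anc st v = l ++ w :: s -> anc st w = w :: s := anc_suffix inv (vis v).
have vertical x y := untested_vertical inv (vis x) (vis y).
have bk := leq_trunc_div k (10 * q); have kb : k <= 20 * q * b := leq_double_divn b0.
pose d := k - 40 * b.
have [/existsP[v far]|/existsPn no_far] := boolP [exists v, 10 * b <= #|far_nbr (anc st) d v|].
  exists (fun=> [set [set v; u] | u in far_nbr (anc st) d v]); split=> [_|F2 hit].
    split; first by apply: imset_pair_edges => u; rewrite inE => /andP[].
    by rewrite card_imset_pair ?(leq_trans _ far) ?leq_mul2r ?orbT // inE adj_irrefl.
  have M0 : 0 < M by rewrite /M !muln_gt0 (leq_trans _ q8).
  have := hit (Ordinal M0); rewrite -setI_eq0 => /set0Pn[f /setIP[fF2 /imsetP[u uN ef]]].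
  apply: (cycle_of_far_edge a_self a_uniq a_sorted _ uN); last by rewrite -ef.
  by rewrite subn_gt0; apply: leq_trans bk; rewrite mulnC ltn_pmul2l //; move: q8; clear; lia.
apply: (exists_chord_family a_self a_suffix a_uniq a_sorted (dfs_tested_edges F) vertical) => //.
- by rewrite mulnC.
- by move=> v; rewrite ltnNge.
Qed.

(** * Random subsets *)

From mathcomp Require Import all_order all_algebra ring lra.
Import Order.TTheory GRing.Theory Num.Theory.
Local Open Scope ring_scope.

Section W.
Variables (R : realFieldType) (E : finType) (A : {set E}).
Implicit Types (p : R) (F B : {set E}).

Definition bernoulli_weight p F : R :=
  \prod_(f in A) (if f \in F then p else 1 - p).

Lemma sum_powerset_prod (a b : E -> R) :
  \sum_(F in powerset A) \prod_(f in A) (if f \in F then a f else b f) =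
  \prod_(f in A) (a f + b f).
Proof.
(* Outside [A] the summands are 0 and 1, so only subsets of [A] survive in the expansion over all of
   [E]. *)
transitivity (\prod_f ((if f \in A then a f else 0) + (if f \in A then b f else 1))).
  rewrite bigA_distr [LHS]big_mkcond; apply: eq_bigr => F _.
  rewrite powersetE; case: ifPn => [sFA|/subsetPn[f fF fA]].
    rewrite [LHS]big_mkcond; apply: eq_bigr => f _.
    by case: ifPn => // fA; rewrite ifN //; apply: contraNN fA => /(subsetP sFA).
  by rewrite (bigD1 f) //= fF (negbTE fA) mul0r.
by rewrite [RHS]big_mkcond; apply: eq_bigr => f _; case: ifP; rewrite ?add0r.
Qed.

Lemma bernoulli_weight_ge0 p F : 0 <= p <= 1 -> 0 <= bernoulli_weight p F.
Proof.
by move=> /andP[p0 p1]; apply: prodr_ge0 => f _; case: ifP; rewrite ?subr_ge0.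
Qed.

Lemma sum_bernoulli_weight p : \sum_(F in powerset A) bernoulli_weight p F = 1.
Proof.
by rewrite sum_powerset_prod big1 // => f _; rewrite addrC subrK.
Qed.

(** Replacing the factor [p] by 0 on [B] discards the sets that meet [B]. *)
Lemma sum_bernoulli_weight_avoid p B : B \subset A ->
  \sum_(F in powerset A | [disjoint F & B]) bernoulli_weight p F = (1 - p) ^+ #|B|.
Proof.
move=> sBA.
transitivity (\prod_(f in A) ((if f \in B then 0 else p) + (1 - p))).
  rewrite -sum_powerset_prod big_mkcondr; apply: eq_bigr => F _.
  rewrite -setI_eq0; case: ifPn => [/eqP dFB|/set0Pn[f /setIP[fF fB]]].
    apply: eq_bigr => f _; case: ifP => // fF; case: ifP => // fB.
    by move/setP: dFB => /(_ f); rewrite !inE fF fB.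
  by rewrite (bigD1 f) ?(subsetP sBA) //= fF fB mul0r.
rewrite (bigID (mem B)) /= [X in _ * X]big1 ?mulr1; last first.
  by move=> f /andP[_ /negbTE ->]; rewrite addrC subrK.
rewrite -prodr_const; apply: eq_big => f; last by case/andP=> _ ->; rewrite add0r.
by apply/andP/idP => [[]//|fB]; rewrite (subsetP sBA).
Qed.

(** Pairing [F] with [e |: F] splits the sum into [p * X] and [(1 - p) * X], since [P] and the
    factors other than that of [e] ignore [e]. *)
Lemma sum_bernoulli_weight_flip p (e : E) (P : pred {set E}) : e \in A ->
  (forall F, P (e |: F) = P (F :\ e)) ->
  \sum_(F in powerset A | P F && (e \in F)) bernoulli_weight p F =
  p * \sum_(F in powerset A | P F) bernoulli_weight p F.
Proof.
move=> eA PE; pose r F := \prod_(f in A | f != e) (if f \in F then p else 1 - p).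
have weightE F : bernoulli_weight p F = (if e \in F then p else 1 - p) * r F.
  by rewrite /bernoulli_weight (bigD1 e).
have rE F G : F :\ e = G :\ e -> r F = r G.
  move=> /setP eFG; apply: eq_bigr => f /andP[_ fe].
  by move: (eFG f); rewrite !inE fe /= => ->.
have addK F : e \notin F -> (e |: F) :\ e = F.
  by move=> eF; rewrite setU1K.
have PD F : e \notin F -> P (e |: F) = P F.
  move=> eF; rewrite PE; congr P; apply/setP => f; rewrite !inE.
  by case: eqP => // ->; rewrite (negbTE eF).
set S1 := LHS.
have ->: \sum_(F in powerset A | P F) bernoulli_weight p F =
    S1 + \sum_(F in powerset A | P F && (e \notin F)) bernoulli_weight p F.
  rewrite (bigID (fun F : {set E} => e \in F)) /=.
  by congr (_ + _); apply: eq_bigl => F; rewrite andbA.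
pose X := \sum_(F in powerset A | P F && (e \notin F)) r F.
have -> : S1 = p * X.
  rewrite mulr_sumr /S1 (reindex_onto (fun F => e |: F) (fun F => F :\ e)) /=; last first.
    by move=> F /and3P[_ _ eF]; rewrite setD1K.
  apply: eq_big => [F|F].
    rewrite !powersetE subUset sub1set eA setU11 /=.
    case eF: (e \in F) => /=; last by rewrite addK ?eF // eqxx PD ?eF // !andbT.
    have -> : ((e |: F) :\ e == F) = false.
      by apply/negbTE/eqP => /setP/(_ e); rewrite !inE eqxx eF.
    by rewrite !andbF.
  rewrite weightE setU11 => /andP[_ /eqP eF]; congr (_ * _); apply: rE.
  by apply/setP => f; rewrite !inE; case: (f == e).
have -> : \sum_(F in powerset A | P F && (e \notin F)) bernoulli_weight p F = (1 - p) * X.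
  by rewrite mulr_sumr; apply: eq_bigr => F /and3P[_ _ eF]; rewrite weightE (negbTE eF).
ring.
Qed.

(** Two-round exposure: grouped by the union [F], the sum over pairs factors over [A], with factor
    [p1 + (1 - p1) * p2] on [F] and [(1 - p1) * (1 - p2)] off it. *)
Lemma sum_bernoulli_weight_setU p1 p2 (phi : {set E} -> R) :
  \sum_(F in powerset A) bernoulli_weight (1 - (1 - p1) * (1 - p2)) F * phi F =
  \sum_(F1 in powerset A) \sum_(F2 in powerset A)
    bernoulli_weight p1 F1 * bernoulli_weight p2 F2 * phi (F1 :|: F2).
Proof.
under [RHS]eq_bigr => F1 F1A.
  rewrite (partition_big (fun F2 => F1 :|: F2) (mem (powerset A))) /=; last first.
    by move=> F2 F2A; move: F1A F2A; rewrite !powersetE subUset => -> ->.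
  over.
rewrite exchange_big /=; apply: eq_bigr => F FA.
under eq_bigr => F1 F1A.
  under eq_bigr => F2 /andP[_ /eqP ->] do rewrite mulrC.
  rewrite -mulr_sumr; over.
rewrite -mulr_sumr mulrC; congr (_ * _).
have inner F1 : F1 \in powerset A ->
   \sum_(F2 in powerset A | F1 :|: F2 == F) (bernoulli_weight p1 F1 * bernoulli_weight p2 F2)
   = \prod_(f in A) (if f \in F1 then (if f \in F then p1 else 0) else
       (1 - p1) * (if f \in F then p2 else 1 - p2)).
  move=> F1A; rewrite -mulr_sumr.
  have [sF1F|nF1F] := boolP (F1 \subset F); last first.
    rewrite [X in _ * X]big_pred0 ?mulr0; last first.
      by move=> F2; apply: contraNF nF1F => /andP[_ /eqP <-]; apply: subsetUl.
    have /subsetPn[f fF1 fF] := nF1F.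
    have fA : f \in A by move: F1A; rewrite powersetE => /subsetP; apply.
    by rewrite (bigD1 f) //= fF1 (negbTE fF) mul0r.
  (* The zeros confine [F2] to subsets of [F] that contain [F :\: F1]. *)
  transitivity (bernoulli_weight p1 F1 *
    \prod_(f in A) ((if f \in F then p2 else 0) +
       (if (f \in F) && (f \notin F1) then 0 else 1 - p2))).
    congr (_ * _); rewrite -sum_powerset_prod big_mkcondr; apply: eq_bigr => F2 F2A.
    case: ifPn => [/eqP eF|neF].
      apply: eq_bigr => f fA; rewrite -eF !inE; case f2: (f \in F2); first by rewrite orbT.
      by rewrite orbF; case: (f \in F1).
    have [f fne] : exists f, (f \in F1 :|: F2) != (f \in F).
      apply/existsP; rewrite -negb_forall; apply: contraNN neF => /forallP h.
      by apply/eqP/setP => f; apply/eqP.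
    have fA : f \in A.
      apply: contraNT fne => fA; move: FA F1A F2A; rewrite !powersetE inE => h h1 h2.
      by rewrite !(contraNF (subsetP _ f) fA).
    rewrite (bigD1 f) //=; move: fne; rewrite inE.
    case fF: (f \in F); case f1: (f \in F1); case f2: (f \in F2) => //= _;
      rewrite ?mul0r //.
    by move/subsetP: sF1F => /(_ f f1); rewrite fF.
  rewrite /bernoulli_weight -big_split /=; apply: eq_bigr => f fA.
  case f1: (f \in F1); first by rewrite (subsetP sF1F) //= addrC subrK mulr1.
  by case: (f \in F) => /=; rewrite ?addr0 ?add0r.
rewrite (eq_bigr _ inner) sum_powerset_prod; apply: eq_bigr => f _.
by case: ifP => _; ring.
Qed.

End W.

(* Probability bounds for the two rounds *)
From mathcomp Require Import all_classical all_reals all_analysis.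
Import numFieldNormedType.Exports.
Local Open Scope classical_set_scope.
Local Open Scope ring_scope.

(** A rational substitute for the bound of [(1 - x) ^+ n] by the exponential of [- n x]. *)
Lemma exprB1_le (R : realFieldType) (x : R) n : 0 <= x <= 1 ->
  (1 - x) ^+ n * (1 + n%:R * x) <= 1.
Proof.
move=> /andP[x0 x1]; elim: n => [|n IH]; first by rewrite expr0 mul0r addr0 mulr1.
rewrite exprS; apply: le_trans IH.
rewrite -[X in _ <= X]mulr1 -!mulrA [(1 - x) * _]mulrCA mulr1 ler_wpM2l ?exprn_ge0 ?subr_ge0 //.
rewrite -natr1; have : 0 <= (n%:R : R) by []; nra.
Qed.

Section Exposure.
Variables (R : realType) (E : finType) (A : {set E}).

(** Union bound over the events that [F] misses [B j]. *)
Lemma sum_bernoulli_weight_hit (I : finType) (p : R) (B : I -> {set E}) c : 0 <= p <= 1 ->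
  (forall j, B j \subset A /\ (c <= #|B j|)%N) ->
  1 - #|I|%:R * (1 - p) ^+ c <=
  \sum_(F in powerset A | [forall j, ~~ [disjoint F & B j]]) bernoulli_weight A p F.
Proof.
move=> p01 hB; have /andP[p0 p1] := p01; have w0 F := bernoulli_weight_ge0 A F p01.
rewrite lerBlDr -[X in X <= _](sum_bernoulli_weight A p).
rewrite (bigID (fun F : {set E} => [forall j, ~~ [disjoint F & B j]])) /= lerD2l.
apply: (@le_trans _ _ (\sum_(F in powerset A) \sum_(j : I | [disjoint F & B j]) bernoulli_weight A p F)).
  rewrite [X in _ <= X](bigID (fun F : {set E} => [forall j, ~~ [disjoint F & B j]])) /=.
  rewrite ler_wpDl ?sumr_ge0 // => [F _|]; first by rewrite sumr_ge0.
  apply: ler_sum => F /andP[_]; rewrite negb_forall => /existsP[j]; rewrite negbK => dj.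
  by rewrite (bigD1 j) //= ler_wpDr // sumr_ge0.
rewrite (exchange_big_dep xpredT) //=.
rewrite mulr_natl -sumr_const; apply: ler_sum => j _.
have [sBA cB] := hB j; rewrite sum_bernoulli_weight_avoid //.
by rewrite ler_wiXn2l ?subr_ge0 // gerBl.
Qed.

(* Summed over e, the probability that e is both in Q and retained is p times the
   probability that it is in Q, because the two events are independent. *)
Lemma sum_bernoulli_weight_card (p : R) (Q : {set E} -> {set E}) n : 0 <= p <= 1 ->
  (forall F, Q F \subset A) -> (forall F, #|Q F :&: F| <= n)%N ->
  (forall (e : E) F, (e \in Q (e |: F)) = (e \in Q (F :\ e))) ->
  p * \sum_(F in powerset A) bernoulli_weight A p F * #|Q F|%:R <= n%:R.
Proof.
move=> p01 QA Qn Qflip; have w0 F := bernoulli_weight_ge0 A F p01.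
have card_sum (X : {set E} -> {set E}) : (forall F, X F \subset A) ->
    \sum_(F in powerset A) bernoulli_weight A p F * #|X F|%:R =
    \sum_(e in A) \sum_(F in powerset A | e \in X F) bernoulli_weight A p F.
  move=> XA; rewrite (exchange_big_dep (mem (powerset A))) /=; last by move=> ? ? _ /andP[].
  apply: eq_bigr => F FA; rewrite -sum1_card natr_sum mulr_sumr.
  by apply: eq_big => [e|e _]; rewrite ?mulr1 // FA; case: (boolP (e \in X F)) =>
    [/(fintype.subsetP (XA F)) ->|]; rewrite ?andbF.
rewrite card_sum // mulr_sumr.
under eq_bigr => e eA do rewrite -(sum_bernoulli_weight_flip p eA (P := fun F => e \in Q F)) //.
rewrite -[X in _ <= X]mul1r -[X in _ <= X * _](sum_bernoulli_weight A p) mulr_suml.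
apply: (@le_trans _ _ (\sum_(F in powerset A) bernoulli_weight A p F * #|Q F :&: F|%:R)).
  rewrite card_sum => [|F]; last exact: fintype.subset_trans (finset.subsetIl _ _) (QA F).
  rewrite le_eqVlt; apply/orP; left; apply/eqP; apply: eq_bigr => e _.
  by apply: eq_bigl => F; rewrite finset.in_setI.
by apply: ler_sum => F _; rewrite ler_wpM2l // ler_nat.
Qed.

End Exposure.

(** * Long cycles in the percolated graph *)

Lemma Pr_percE (R : realType) (G : sgraph) (p : R) (P : sgraph -> Prop) :
  Pr_perc G p P = \sum_(F in powerset (edges G))
    bernoulli_weight (edges G) p F * (`[< P (spanning_subgraph F) >])%:R.
Proof.
rewrite /Pr_perc big_mkcondr; apply: eq_bigr => F _.
by case: asboolP; rewrite ?mulr1 ?mulr0.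
Qed.

Lemma Pr_perc_le1 (R : realType) (G : sgraph) (p : R) (P : sgraph -> Prop) :
  0 <= p <= 1 -> Pr_perc G p P <= 1.
Proof.
move=> p01; rewrite Pr_percE -[X in _ <= X](sum_bernoulli_weight (edges G) p).
by apply: ler_sum => F _; rewrite ler_piMr ?bernoulli_weight_ge0 // lern1 leq_b1.
Qed.

(** The numerators account for the two failures: [2 * Z] for too many tested edges in the first
    round, [8 * q * M] for a set [B j] missed by the second. *)
Lemma Pr_perc_cycle_ge (R : realType) (G : sgraph) (p : R) k q :
  let M := (20 * q * (20 * q).+1)%N in
  let Z := (4 * q * (1 + (1 + 2 * q) * (1 + M)) * M).+1 in
  (8 <= q)%N -> (10 * q <= k)%N -> min_degree_at_least G k -> 0 < p <= 1 ->
  1 - (2 * Z + 8 * q * M)%N%:R / (p * k%:R) <=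
  Pr_perc G p (has_cycle_at_least ((k - 40 * (k %/ (10 * q)))%N%:R : R)).
Proof.
move=> M Z q8 kq min_deg /andP[p0 p1].
set b := (k %/ (10 * q))%N; set l : R := (k - 40 * b)%N%:R; pose A := edges G.
have q0 : (0 < 10 * q)%N by rewrite muln_gt0 (leq_trans _ q8).
have b0 : (0 < b)%N by rewrite divn_gt0.
have V0 : (0 < #|G|)%N by case: min_deg.
have k0 : (0 : R) < k%:R by rewrite ltr0n (leq_trans q0).
(* This [p2] solves [(1 - p1') * (1 - p2) = 1 - p]. *)
pose p1' := p / 2; pose p2 := p1' / (1 - p1').
have p1'01 : 0 <= p1' <= 1 by rewrite /p1'; lra.
have p1'0 : 0 < p1' by rewrite /p1'; lra.
have d0 : 0 < 1 - p1' by rewrite /p1'; lra.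
have p2_ge : p1' <= p2 by rewrite /p2 ler_pdivlMr // /p1'; nra.
have p2_le : p2 <= 1 by rewrite /p2 ler_pdivrMr // /p1'; lra.
have p201 : 0 <= p2 <= 1 by rewrite p2_le andbT (le_trans (ltW p1'0)).
have pE : p = 1 - (1 - p1') * (1 - p2).
  by rewrite /p2 mulrBr mulr1 mulrCA divff ?gt_eqF // /p1'; field.
pose good (F : {set {set G}}) := (#|tested (dfs_run F)| * Z <= #|G| * k)%N.
have w1 F := bernoulli_weight_ge0 A F p1'01; have w2 F := bernoulli_weight_ge0 A F p201.
pose x : R := (8 * q * M)%N%:R / (p * k%:R).
have pk0 : 0 < p * k%:R by rewrite mulr_gt0.
have x0 : 0 <= x by rewrite divr_ge0 // ltW.
(* From [p2 >= p / 2] and [k <= 20 * q * b] follows [5 * b * p2 >= p * k / (8 * q)]. *)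
have hit_bound : M%:R * (1 - p2) ^+ (5 * b) <= x.
  have := exprB1_le (5 * b) p201; set y := _ ^+ _ => hy.
  have y0 : 0 <= y by rewrite exprn_ge0 // subr_ge0.
  have kb : (k%:R : R) <= (20 * q * b)%N%:R.
    by rewrite ler_nat leq_double_divn.
  rewrite /x ler_pdivlMr //.
  have -> : (8 * q * M)%N%:R = M%:R * (8 * q%:R) :> R by rewrite !natrM; ring.
  rewrite -mulrA ler_wpM2l //.
  apply: (@le_trans _ _ (y * (p * (20 * q * b)%N%:R))).
    by rewrite !ler_wpM2l // ltW.
  have -> : y * (p * (20 * q * b)%N%:R) = (y * ((5 * b)%N%:R * p1')) * (8 * q%:R).
    by rewrite /p1' !natrM; field.
  rewrite ler_piMl ?mulr_ge0 //; apply: le_trans hy; rewrite ler_wpM2l //.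
  by rewrite ler_wpDl // ler_wpM2l.
have inner F1 : (good F1)%:R - x <= \sum_(F2 in powerset A) bernoulli_weight A p2 F2 *
    (`[< has_cycle_at_least l (spanning_subgraph (F1 :|: F2)) >])%:R.
  case: (boolP (good F1)) => [good1|_]; last first.
    rewrite sub0r (@le_trans _ _ 0) ?oppr_le0 // sumr_ge0 // => F2 _; exact: mulr_ge0.
  have [B [hB hcyc]] := exists_hitting_family q8 b0 min_deg good1.
  have := sum_bernoulli_weight_hit p201 hB; rewrite card_ord => hit.
  apply: (@le_trans _ _ (1 - M%:R * (1 - p2) ^+ (5 * b))); first by rewrite lerD2l lerN2.
  apply: le_trans hit _; rewrite big_mkcondr; apply: ler_sum => F2 _.
  case: ifPn => [/forallP/hcyc[c [cyc sc]]|_]; last exact: mulr_ge0.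
  rewrite asboolT ?mulr1 //; exists c; split=> //; by rewrite ler_nat.
(* Markov's inequality: the mean number of tested edges is at most [#|G| / p1'], the threshold is
   [#|G| * k / Z]. *)
have good_bound : 1 - (2 * Z)%N%:R / (p * k%:R) <=
    \sum_(F in powerset A) bernoulli_weight A p1' F * (good F)%:R.
  have := sum_bernoulli_weight_card p1'01 (@dfs_tested_edges G) (@card_dfs_testedI G)
    (fun e F => dfs_tested_setU1 F e).
  set X := \sum_(F in _) _ => hX.
  rewrite lerBlDr -lerBlDl -[X in X - _](sum_bernoulli_weight A p1') -sumrB.
  rewrite ler_pdivlMr // mulr_suml.
  have n0 : (0 : R) < #|G|%:R by rewrite ltr0n.
  have -> : (2 * Z)%N%:R = Z%:R * 2 :> R by rewrite mulnC natrM.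
  rewrite -(ler_pM2r n0).
  apply: (@le_trans _ _ (Z%:R * 2 * (p1' * X))); last by apply: ler_wpM2l hX; rewrite mulr_ge0.
  rewrite mulr_suml /X !mulr_sumr; apply: ler_sum => F _.
  have -> : bernoulli_weight A p1' F - bernoulli_weight A p1' F * (good F)%:R =
    bernoulli_weight A p1' F * (1 - (good F)%:R) by ring.
  rewrite /good leqNgt; case: ltnP => [big|_] /=; last first.
    by rewrite subrr mulr0 !mul0r !mulr_ge0 // ltW.
  rewrite subr0 mulr1.
  have : (#|G|%:R * k%:R : R) <= #|tested (dfs_run F)|%:R * Z%:R by rewrite -!natrM ler_nat ltnW.
  have -> : bernoulli_weight A p1' F * (p * k%:R) * #|G|%:R =
     (bernoulli_weight A p1' F * p) * (#|G|%:R * k%:R) by ring.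
  have -> : Z%:R * 2 * (p1' * (bernoulli_weight A p1' F * #|tested (dfs_run F)|%:R)) =
     (bernoulli_weight A p1' F * p) * (#|tested (dfs_run F)|%:R * Z%:R) by rewrite /p1'; field.
  by move=> h; rewrite ler_wpM2l // mulr_ge0 // ltW.
rewrite Pr_percE [X in bernoulli_weight _ X]pE sum_bernoulli_weight_setU.
apply: (@le_trans _ _ (\sum_(F in powerset A) bernoulli_weight A p1' F * ((good F)%:R - x))).
  under eq_bigr => F _ do rewrite mulrBr.
  rewrite sumrB -mulr_suml sum_bernoulli_weight mul1r natrD mulrDl opprD addrA lerD2r.
  exact: good_bound.
apply: ler_sum => F1 _.
under eq_bigr => F2 _ do rewrite -mulrA.
by rewrite -mulr_sumr ler_wpM2l.
Qed.

Theorem theorem1 (R : realType) (G : nat -> sgraph) (p : nat -> R)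
  (hG : forall k : nat, (0 < k)%N -> min_degree_at_least (G k) k)
  (hp : forall k : nat, (0 < k)%N -> 0 <= p k <= 1)
  (hpk : (fun k : nat => p k * k%:R) @ \oo --> +oo)
  (delta : R) (hdelta : 0 < delta) :
  (fun k : nat => Pr_perc (G k) (p k) (has_cycle_at_least ((1 - delta) * k%:R)))
    @ \oo --> (1 : R).
Proof.
(* The loss [40 * (k %/ (10 * q))] is at most [4 * k / q], hence at most [delta * k]. *)
pose q := (Num.bound (4 / delta) + 8)%N.
have q8 : (8 <= q)%N by rewrite leq_addl.
have q_delta : 4 <= delta * q%:R.
  rewrite -ler_pdivrMl // mulrC natrD ler_wpDr // ltW //.
  by apply: archi_boundP; rewrite divr_ge0 // ltW.
pose M := (20 * q * (20 * q).+1)%N.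
pose Z := (4 * q * (1 + (1 + 2 * q) * (1 + M)) * M).+1.
pose C : R := (2 * Z + 8 * q * M)%N%:R.
apply/cvgrPdist_le => eps eps0.
have /cvgryPge/(_ (C / eps)) large := hpk.
near=> k.
have k0 : (0 < k)%N by near: k; exists 1%N.
have kq : (10 * q <= k)%N by near: k; exists (10 * q)%N.
have pk_ge : C / eps <= p k * k%:R by near: k.
have C0 : 0 < C by rewrite ltr0n addn_gt0.
have pk0 : 0 < p k * k%:R by apply: lt_le_trans pk_ge; rewrite divr_gt0.
have p0 : 0 < p k by move: pk0; rewrite pmulr_lgt0 ?ltr0n.
have p01 := hp k k0; have /andP[_ p1] := p01.
have Pr_ge := @Pr_perc_cycle_ge R (G k) (p k) k q q8 kq (hG k k0).
rewrite p0 p1 in Pr_ge; have {}Pr_ge := Pr_ge isT; rewrite -/M -/Z -/C in Pr_ge.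
rewrite ger0_norm ?subr_ge0 ?Pr_perc_le1 // lerBlDr -lerBlDl.
apply: (@le_trans _ _ (1 - C / (p k * k%:R))).
  by rewrite lerD2l lerN2 ler_pdivrMr // mulrC -ler_pdivrMr.
apply: le_trans Pr_ge _; rewrite !Pr_percE; apply: ler_sum => F _.
rewrite ler_wpM2l ?bernoulli_weight_ge0 // ler_nat.
case: (asboolP (has_cycle_at_least ((_ - _)%N%:R : R) _)) => // -[c [cyc hc]].
rewrite asboolT //; exists c; split=> //; apply: le_trans hc.
have : ((k%:R : R) <= (k - 40 * (k %/ (10 * q)))%N%:R + (40 * (k %/ (10 * q)))%N%:R).
  by rewrite -natrD ler_nat addnC -leq_subLR.
have : ((40 * (k %/ (10 * q)))%N%:R : R) <= delta * k%:R.
  have : ((10 * q * (k %/ (10 * q)))%N%:R : R) <= k%:R by rewrite ler_nat mulnC leq_trunc_div.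
  rewrite !natrM; set t : R := (_ %/ _)%:R => h.
  have t0 : 0 <= t by [].
  nra.
lra.
Unshelve. all: by end_near.
Qed.
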